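(* For every choice of control parameters $\lambda_\ell,\overline\theta,\underline\theta\in(0,1)$ there is a constant $C$ depending solely on $\lambda_\ell,\overline\theta,\underline\theta$ such that the following holds for the Composite Truncated Level (CTL) algorithm (described in the context) applied to $\mathrm{Opt}=\min_{x\in X}\{\phi(x)=\psi(x)+f(x)\}$: for every $\epsilon\in(0,L_\phi\Omega)$, the overall number of CTL iterations until an $\epsilon$-optimal solution, as certified by the current gap (i.e., until $\overline\phi-\underline\phi\le\epsilon$, so that the current approximate solution $\widehat x\in X$ satisfies $\phi(\widehat x)-\mathrm{Opt}\le\epsilon$), is built does not exceed $$N(\epsilon)=C\left(\frac{L_\phi\Omega}{\epsilon}\right)^2 .$$
   Context: **Problem.** $X\subset\mathbb{R}^n$ is nonempty, convex, closed and bounded; $\psi,f:X\to\mathbb{R}$ are Lipschitz continuous convex functions; $\phi=\psi+f$. **Proximal setup.** $\|\cdot\|$ is a norm on $\mathbb{R}^n$ and $\omega:X\to\mathbb{R}$ is continuously differentiable and strongly convex with modulus 1: $\langle\nabla\omega(x)-\nabla\omega(y),x-y\rangle\ge\|x-y\|^2$ for all $x,y\in X$. The Bregman distance is $V_x(y)=\omega(y)-\omega(x)-\langle\nabla\omega(x),y-x\rangle$ and $\Omega=[2\max_{x,y\in X}V_x(y)]^{1/2}$. **Oracle.** Given $x\in X$, the oracle returns $\phi(x)$ and a piece $\phi_x(\cdot)=\psi(\cdot)+f_x(\cdot):X\to\mathbb{R}$, where $f_x$ is a Lipschitz continuous convex function on $X$ with $f_x(y)\le f(y)$ for all $y\in X$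 and $f_x(x)=f(x)$. The pieces are uniformly Lipschitz: $|\phi_x(u)-\phi_x(v)|\le L_\phi\|u-v\|$ for all $x,u,v\in X$, with $L_\phi<\infty$. **CTL algorithm.** Parameters: $\lambda_\ell,\overline\theta,\underline\theta\in(0,1)$ and an integer $\tau\ge1$ (maximal bundle size). The algorithm maintains an upper bound $\overline\phi$ and a lower bound $\underline\phi$ on $\mathrm{Opt}$, an approximate solution $\widehat x\in X$ with $\phi(\widehat x)=\overline\phi$, and a bundle (a nonempty collection of at most $\tau$ pieces). The current gap is $\overline\phi-\underline\phi$. *Initialization.* Call the oracle at an arbitrary $x_{\rm ini}\in X$; set $\overline\phi=\phi(x_{\rm ini})$, $\widehat x=x_{\rm ini}$, $\underline\phi=\min_{x\in X}\phi_{x_{\rm ini}}(x)$, and let the bundle be $\{\phi_{x_{\rm ini}}\}$. *Phases.* Iterations are split into consecutive phases. At the start of a phase, an arbitrary prox-center $\overline x\in X$ is selected, the level is set to $\ell=\lambda_\ell\underline\phi+(1-\lambda_\ell)\overline\phi$, and $\overline\Delta=\overline\phi-\ell$, $\underline\Delta=\ell-\underline\phi$ are computed (with the current values of $\overline\phi,\underline\phi$); $\overline x,\ell,\overline\Delta,\underline\Delta$ are kept fixed during the phase. The first query point of the phase is $x=\overline x$. *Iteration of a phase, with query point $x$.* 1. Call the oracle at $x$ to get $\phi(x)$ and $\phi_x$. If $\phi(x)<\overline\phi$, set $\overline\phi:=\phi(x)$, $\widehat x:=x$. Add $\phi_x$ to the bundle and, if necessary, remove one old piece so that the bundle $\{\phi_1,\dots,\phi_{\tau_{\mathcal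 B}}\}$ has $\tau_{\mathcal B}\le\tau$ pieces. 2. If $\phi(x)-\ell\le\overline\theta\,\overline\Delta$, terminate the phase and start the next one. Otherwise, with $\widehat\phi(y)=\max_{1\le\iota\le\tau_{\mathcal B}}\phi_\iota(y)$, compute $$\widetilde\phi=\min_y\{\widehat\phi(y):\ y\in X,\ \langle\nabla\omega(x)-\nabla\omega(\overline x),y-x\rangle\ge0\}$$ ($\widetilde\phi=+\infty$ if infeasible) and update $\underline\phi:=\max[\underline\phi,\min[\widetilde\phi,\ell]]$. If now $\ell-\underline\phi\le\underline\theta\,\underline\Delta$, terminate the phase and start the next one. 3. Otherwise, let the next query point of the phase be the optimal solution of $$\min_y\{V_{\overline x}(y):\ y\in X,\ \widehat\phi(y)\le\ell,\ \langle\nabla\omega(x)-\nabla\omega(\overline x),y-x\rangle\ge0\},$$ and pass to the next iteration of the phase. *)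

(* Defs.v *)
(* MathComp / MathComp-Analysis, over an arbitrary R : realType.
   R^n is 'rV[R]_n; functions on X are total functions used only on X. *)
From mathcomp Require Import all_boot all_order all_algebra.
From mathcomp Require Import all_classical all_reals all_analysis.

Set Implicit Arguments.
Unset Strict Implicit.
Unset Printing Implicit Defensive.

Import Order.TTheory GRing.Theory Num.Theory.
Import numFieldNormedType.Exports.
Local Open Scope classical_set_scope.
Local Open Scope ring_scope.

Definition dotv (R : realType) (n : nat) (u v : 'rV[R]_n) : R :=
  \sum_(i < n) u 0 i * v 0 i.

Definition is_norm (R : realType) (n : nat) (N : 'rV[R]_n -> R) : Prop :=
  [/\ forall u, N u = 0 -> u = 0,
      forall (a : R) u, N (a *: u) = `|a| * N u
    & forall u v, N (u + v) <= N u + N v].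

Definition lipschitz_wrt_with (R : realType) (n : nat) (N : 'rV[R]_n -> R)
    (X : set 'rV[R]_n) (L : R) (h : 'rV[R]_n -> R) : Prop :=
  forall u v, X u -> X v -> `|h u - h v| <= L * N (u - v).

Definition lipschitz_wrt (R : realType) (n : nat) (N : 'rV[R]_n -> R)
    (X : set 'rV[R]_n) (h : 'rV[R]_n -> R) : Prop :=
  exists L : R, lipschitz_wrt_with N X L h.

(* w is continuously differentiable on X with gradient g. Differentiability is
   relative to X, i.e. w y = w x + <g x, y - x> + o(y - x) for y in X tending
   to x: w is only given on X, and X may have empty interior. If w is C^1 on a
   neighbourhood of X, the usual gradient satisfies this. The norm `|y - x| is
   the library's sup norm; all norms on R^n are equivalent. *)
Definition C1_on_with_gradient (R : realType) (n : nat) (X : set 'rV[R]_n)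
    (w : 'rV[R]_n -> R) (g : 'rV[R]_n -> 'rV[R]_n) : Prop :=
  (forall x, X x -> forall e : R, 0 < e ->
     \forall y \near within X (nbhs x),
       `|w y - w x - dotv (g x) (y - x)| <= e * `|y - x|) /\
  {within X, continuous g}.

Definition strongly_convex_gradient (R : realType) (n : nat)
    (N : 'rV[R]_n -> R) (X : set 'rV[R]_n)
    (g : 'rV[R]_n -> 'rV[R]_n) : Prop :=
  forall x y, X x -> X y -> N (x - y) ^+ 2 <= dotv (g x - g y) (x - y).

Definition bregman (R : realType) (n : nat) (w : 'rV[R]_n -> R)
    (g : 'rV[R]_n -> 'rV[R]_n) (x y : 'rV[R]_n) : R :=
  w y - w x - dotv (g x) (y - x).

(* The maximum is written as a supremum; it is attained, the Bregman distance
   being continuous on the compact set X * X. *)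
Definition prox_diameter (R : realType) (n : nat) (X : set 'rV[R]_n)
    (w : 'rV[R]_n -> R) (g : 'rV[R]_n -> 'rV[R]_n) : R :=
  Num.sqrt (2 * sup [set bregman w g p.1 p.2 | p in X `*` X]).

(* The minimum of h over X, attained for X nonempty compact, h continuous. *)
Definition minval (R : realType) (n : nat) (X : set 'rV[R]_n)
    (h : 'rV[R]_n -> R) : R :=
  inf [set h x | x in X].

Section CTL.
Context (R : realType) (n : nat).
Notation V := ('rV[R]_n).

(* The piece returned at x is phi_x = psi + fpiece x. *)
Record ctl_data := CtlData {
  ctl_X : set V;
  ctl_psi : V -> R;
  ctl_f : V -> R;
  ctl_fpiece : V -> V -> R;
  ctl_w : V -> R;
  ctl_grad : V -> V;
  ctl_lam : R;
  ctl_thU : R;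
  ctl_thL : R;
  ctl_tau : nat }.

Record ctl_phase := CtlPhase {
  ph_center : V;
  ph_level : R;
  ph_gapU : R;
  ph_gapL : R;
  ph_query : V }.

(* [st_phase = None] when the next iteration opens a new phase. *)
Record ctl_state := CtlState {
  st_ub : R;
  st_lb : R;
  st_xhat : V;
  st_bundle : seq (V -> R);
  st_phase : option ctl_phase }.

Variable D : ctl_data.

Definition ctl_phi (x : V) : R := ctl_psi D x + ctl_f D x.

Definition ctl_piece (x : V) : V -> R :=
  fun y => ctl_psi D y + ctl_fpiece D x y.

Definition bundle_max (B : seq (V -> R)) (y : V) : \bar R :=
  \big[Order.max/-oo%E]_(p <- B) (p y)%:E.

(* Adds the new piece p; if the bundle B is full, the old piece number i is
   dropped. *)
Definition bundle_add (i : nat) (p : V -> R) (B : seq (V -> R)) :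
    seq (V -> R) :=
  if (size B < ctl_tau D)%N then p :: B else p :: take i B ++ drop i.+1 B.

Definition cut (xbar x : V) : set V :=
  [set y | ctl_X D y /\ 0 <= dotv (ctl_grad D x - ctl_grad D xbar) (y - x)].

(* An infimum over the empty set is +oo, as required when infeasible. *)
Definition cut_min (B : seq (V -> R)) (xbar x : V) : \bar R :=
  ereal_inf [set bundle_max B y | y in cut xbar x].

Definition query_feasible (B : seq (V -> R)) (l : R) (xbar x : V) : set V :=
  cut xbar x `&` [set y | (bundle_max B y <= l%:E)%E].

(* The optimal solution of the auxiliary problem is unique, by strong
   convexity; the default value x of [xget] stands for nonexistence. *)
Definition next_query (B : seq (V -> R)) (l : R) (xbar x : V) : V :=
  let V_ := bregman (ctl_w D) (ctl_grad D) xbar in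
  xget x [set y | query_feasible B l xbar x y /\
                  forall z, query_feasible B l xbar x z -> V_ y <= V_ z].

Definition ctl_init (xini : V) : ctl_state :=
  CtlState (ctl_phi xini) (minval (ctl_X D) (ctl_piece xini)) xini
           [:: ctl_piece xini] None.

Definition open_phase (xbar : V) (s : ctl_state) : ctl_phase :=
  let l := ctl_lam D * st_lb s + (1 - ctl_lam D) * st_ub s in
  CtlPhase xbar l (st_ub s - l) (l - st_lb s) xbar.

(* One iteration; [xbar] is the prox-center selected if the iteration opens a
   phase, [i] the index of the old piece dropped if the bundle is full. *)
Definition ctl_iter (xbar : V) (i : nat) (s : ctl_state) : ctl_state :=
  let P := if st_phase s is Some P then P else open_phase xbar s in
  let x := ph_query P in
  let l := ph_level P in
  let better := ctl_phi x < st_ub s in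
  let ub := if better then ctl_phi x else st_ub s in
  let xhat := if better then x else st_xhat s in
  let B := bundle_add i (ctl_piece x) (st_bundle s) in
  if ctl_phi x - l <= ctl_thU D * ph_gapU P then
    CtlState ub (st_lb s) xhat B None
  else
    let lb :=
      Num.max (st_lb s) (fine (Order.min (cut_min B (ph_center P) x) l%:E)) in
    if l - lb <= ctl_thL D * ph_gapL P then CtlState ub lb xhat B None
    else
      CtlState ub lb xhat B
        (Some (CtlPhase (ph_center P) l (ph_gapU P) (ph_gapL P)
                        (next_query B l (ph_center P) x))).

(* The state after k iterations. The selections of the prox-centers and of the
   removed pieces are arbitrary sequences, indexed by the iteration; as the
   rest is deterministic, this covers choices depending on the history. *)
Fixpoint ctl_run (xini : V) (center : nat -> V) (rm : nat -> nat) (k : nat) :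
    ctl_state :=
  if k is j.+1 then ctl_iter (center j) (rm j) (ctl_run xini center rm j)
  else ctl_init xini.

End CTL.

(* Main.v *)
Require Import Defs.
From mathcomp Require Import all_boot all_order all_algebra.
From mathcomp Require Import all_classical all_reals all_analysis.
From mathcomp Require Import ring lra.

Set Implicit Arguments.
Unset Strict Implicit.
Unset Printing Implicit Defensive.

Import Order.TTheory GRing.Theory Num.Theory.
Import numFieldNormedType.Exports.
Local Open Scope classical_set_scope.
Local Open Scope ring_scope.

(** Write [V] for the Bregman distance, [M = (Lphi * Omega)^2], and let [d] be
    the gap at the start of a phase with prox-center [c].  In the lemmas below,
    [L], [Cphases] and [Csteps] stand for [Lphi], [phases_const] and
    [steps_const].

    The strong convexity of [w], integrated along segments, gives
    [V x y >= N (y - x)^2 / 2] ([bregman_ge_norm]), so that the diameter of [X]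
    for [N] is at most [Omega].  Inside a phase, the linear cut at the query
    point [x] is satisfied by the next query point [x'], and the three-point
    identity turns this into [V c x' >= V c x + N (x' - x)^2 / 2].  As the phase
    goes on, the piece at [x] has to fall by at least [thU * lam * d] between
    [x] and [x'], hence [Lphi * N (x' - x)] is at least that much.  So each
    iteration that does not end the phase raises [V c] by a fixed multiple of
    [(d / Lphi)^2] ([potential_step]), while [V c <= Omega^2 / 2] throughout.

    The lower bound stays valid because [x'] minimizes [V c] over a convex set:
    by first-order optimality no point of the level set is lost to the next
    cut ([next_queryP]), so the minimum of the model over the cut, truncated at
    the level, never exceeds a value of the objective ([level_bound_le_phi]).

    A completed phase multiplies the gap by at most [contraction < 1].  Rather
    than summing phase lengths, the proof carries the inequality
    [k * d^2 <= Cphases * M + Csteps * (2 * Lphi^2 * V c x)] along the run, [k]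
    being the number of iterations so far and [x] the query point.  An inner
    iteration preserves it because [V c] increases enough to pay for [d^2]; at
    the end of a phase the right-hand side, together with the [d^2] of the last
    iteration, is at most [(Cphases + Csteps + 1) * M], and [Cphases] is chosen
    so that the decrease of the gap brings the product back below [Cphases * M]
    ([end_phase_inv]).
    Thus [k * gap^2 <= (Cphases + Csteps) * M] at every iteration
    ([ctl_inv_gap]), and the first integer [k] for which this forces
    [gap <= eps] is of order [M / eps^2]. *)

(** * Scalar products, norms and segments *)

Section Vectors.
Context {R : realType} {n : nat}.
Implicit Types u v c : 'rV[R]_n.

Lemma dotvDl u v c : dotv (u + v) c = dotv u c + dotv v c.
Proof.
by rewrite /dotv -big_split/=; apply: eq_bigr => i _; rewrite mxE mulrDl.
Qed.

Lemma dotvNl u c : dotv (- u) c = - dotv u c.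
Proof. by rewrite /dotv -sumrN; apply: eq_bigr => i _; rewrite mxE mulNr. Qed.

Lemma dotvBl u v c : dotv (u - v) c = dotv u c - dotv v c.
Proof. by rewrite dotvDl dotvNl. Qed.

Lemma dotvDr c u v : dotv c (u + v) = dotv c u + dotv c v.
Proof.
by rewrite /dotv -big_split/=; apply: eq_bigr => i _; rewrite mxE mulrDr.
Qed.

Lemma dotvZr c (a : R) u : dotv c (a *: u) = a * dotv c u.
Proof. by rewrite /dotv mulr_sumr; apply: eq_bigr => i _; rewrite mxE mulrCA. Qed.

Lemma dotvNr c u : dotv c (- u) = - dotv c u.
Proof. by rewrite -scaleN1r dotvZr mulN1r. Qed.

Lemma dotvBr c u v : dotv c (u - v) = dotv c u - dotv c v.
Proof. by rewrite dotvDr dotvNr. Qed.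

Lemma dotv0l u : dotv 0 u = 0.
Proof. by rewrite -(subrr u) dotvBl subrr. Qed.

Lemma ler_coord_norm u (i : 'I_n) : `|u 0 i| <= `|u|.
Proof.
rewrite [leRHS]/Num.norm/= mx_normrE.
exact: (le_bigmax _ (fun ij : 'I_1 * 'I_n => `|u ij.1 ij.2|) (0, i)).
Qed.

Lemma ler_norm_dotv u v : `|dotv u v| <= n%:R * (`|u| * `|v|).
Proof.
rewrite (le_trans (ler_norm_sum _ _ _))//.
rewrite mulr_natl -[X in _ *+ X]card_ord -sumr_const ler_sum// => i _.
by rewrite normrM ler_pM// ler_coord_norm.
Qed.

Lemma is_norm_sup : is_norm (fun u : 'rV[R]_n => `|u|).
Proof. by split=> [u /normr0_eq0//|a u|u v]; rewrite ?normrZ ?ler_normD. Qed.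

Context {N : 'rV[R]_n -> R} (hN : is_norm N).

Lemma is_norm0 : N 0 = 0.
Proof. by case: hN => _ NZ _; rewrite -(scale0r 0) NZ normr0 mul0r. Qed.

Lemma is_normN u : N (- u) = N u.
Proof. by case: hN => _ NZ _; rewrite -scaleN1r NZ normrN1 mul1r. Qed.

Lemma is_norm_ge0 u : 0 <= N u.
Proof.
have [_ _ /(_ u (- u))] := hN.
rewrite subrr is_norm0 is_normN; lra.
Qed.

(** In finite dimension every norm is dominated by the sup norm; this is what
    makes functions that are Lipschitz for [N] continuous. *)
Lemma is_norm_le_sup : exists2 K, 0 < K & forall u, N u <= K * `|u|.
Proof.
have [_ NZ ND] := hN.
have NS u : N u <= \sum_(j < n) N (u 0 j *: 'e_j).
  rewrite {1}[u]row_sum_delta.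
  elim/big_ind2 : _ => [|a a' b b' ha hb|//]; first by rewrite is_norm0.
  by rewrite (le_trans (ND _ _))// lerD.
exists (1 + \sum_(j < n) N 'e_j).
  by rewrite ltr_pwDl// sumr_ge0// => j _; exact: is_norm_ge0.
move=> u; rewrite (le_trans (NS u))// mulrDl mul1r mulr_suml.
rewrite ler_wpDl// ler_sum// => j _.
by rewrite NZ mulrC ler_wpM2l ?is_norm_ge0// ler_coord_norm.
Qed.

Lemma lipschitz_wrt_continuous (X : set 'rV[R]_n) h :
  lipschitz_wrt N X h -> {within X, continuous h}.
Proof.
move=> [L hL]; have [K K0 NK] := is_norm_le_sup.
apply/subspace_continuousP => x Xx; apply/cvgrPdist_le => e e0.
have near_x : \forall y \near x, `|x - y| <= e / ((`|L| + 1) * K).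
  apply/nbhs_normP; exists (e / ((`|L| + 1) * K)) => [|y /ltW//] /=.
  by rewrite divr_gt0// mulr_gt0// ltr_wpDl.
near=> y.
have Xy : X y by near: y; exact: withinT.
have yx : `|x - y| <= e / ((`|L| + 1) * K) by near: y; exact: cvg_within near_x.
rewrite ler_pdivlMr ?mulr_gt0 ?ltr_wpDl// in yx.
apply: le_trans (hL _ _ Xx Xy) (le_trans _ yx).
rewrite [leRHS]mulrC -mulrA.
have LL : L <= `|L| + 1 by rewrite ler_wpDr// ler_norm.
rewrite (le_trans (ler_wpM2r (is_norm_ge0 _) LL))//.
by rewrite ler_wpM2l ?addr_ge0.
Unshelve. all: by end_near. Qed.

End Vectors.

Section Segments.
Context {R : realType} {n : nat} {X : set 'rV[R]_n}.

Lemma convex_set_segment x y (t : R) : convex_set X -> X x -> X y ->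
  0 <= t <= 1 -> X (x + t *: (y - x)).
Proof.
move=> cX Xx Xy t01.
have /andP[t0 t1] := t01.
have := cX y x (Itv01 t0 t1) (mem_set Xy) (mem_set Xx).
rewrite inE /conv/=.
suff -> : x + t *: (y - x) = t *: y + (1 - t) *: x by [].
by rewrite scalerBr scalerBl scale1r addrCA addrA.
Qed.

Lemma convex_function_segment (h : 'rV[R]_n -> R) x y (t : R) :
  convex_function X h -> X x -> X y -> 0 <= t <= 1 ->
  h (x + t *: (y - x)) <= h x + t * (h y - h x).
Proof.
move=> ch Xx Xy /andP[t0 t1].
have := ch (Itv01 t0 t1) y x (mem_set Xy) (mem_set Xx).
rewrite [X in _ <= X -> _]/conv/= /conv/=.
have -> : x + t *: (y - x) = t *: y + (1 - t) *: x.
  by rewrite scalerBr scalerBl scale1r addrCA addrA.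
have -> : h x + t * (h y - h x) = t * h y + (1 - t) * h x by ring.
by [].
Qed.

End Segments.

(** * Bregman distances *)

(** The mean value theorem for a derivative taken relative to the interval, so
    that one-sided derivatives at the end points suffice. *)
Lemma ge0_relative_derive_le (R : realType) (h dh : R -> R) :
  (forall c : R, 0 <= c <= 1 -> forall e : R, 0 < e ->
     \forall t \near within `[0, 1] (nbhs c),
       `|h t - h c - (t - c) * dh c| <= e * `|t - c|) ->
  (forall c : R, 0 < c < 1 -> 0 <= dh c) -> h 0 <= h 1.
Proof.
move=> hd dh0.
have hcont : {within `[0, 1], continuous h}.
  apply/subspace_continuousP => c; rewrite /= in_itv/= => c01.
  apply/cvgrPdist_le => e e0.
  have near_c : \forall t \near c, `|c - t| <= e / (`|dh c| + 1).
    apply/nbhs_normP; exists (e / (`|dh c| + 1)) => [|t /ltW//] /=.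
    by rewrite divr_gt0// ltr_wpDl.
  have H1 := hd c c01 1 ltr01.
  near=> t.
  have tc : `|c - t| <= e / (`|dh c| + 1) by near: t; exact: cvg_within near_c.
  have ht : `|h t - h c - (t - c) * dh c| <= 1 * `|t - c| by near: t.
  rewrite ler_pdivlMr ?ltr_wpDl// in tc.
  rewrite distrC (le_trans _ tc)// mulrDr mulr1 [`|c - t|]distrC -normrM.
  rewrite [leRHS]addrC.
  rewrite -[h t - h c](subrK ((t - c) * dh c)).
  by rewrite (le_trans (ler_normD _ _))// lerD2r -[leRHS]mul1r.
have hder (c : R) : c \in `]0, 1[ -> is_derive c 1 h (dh c).
  rewrite in_itv/= => /andP[c0 c1].
  apply/is_derive1_caratheodory.
  pose q z := if z == c then dh c else (h z - h c) / (z - c).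
  have qc : q c = dh c by rewrite /q eqxx.
  exists q; split=> //.
  - move=> z; rewrite /q; case: eqVneq => [->|zc]; first by rewrite !subrr mulr0.
    by rewrite divfK// subr_eq0.
  - apply/cvgrPdist_le => e e0; rewrite qc.
    have c01 : 0 <= c <= 1 by rewrite !ltW.
    have Hn : \forall t \near c, `[0, 1]%classic t ->
       `|h t - h c - (t - c) * dh c| <= e * `|t - c| := hd c c01 e e0.
    near=> t; rewrite /q.
    case: eqVneq => [_|tc]; first by rewrite subrr normr0 ltW.
    have t01 : `[0, 1]%classic t.
      rewrite /= in_itv/=; apply/andP; split; apply/ltW; near: t.
        exact: lt_nbhsr.
      exact: lt_nbhsl.
    have : `[0, 1]%classic t -> `|h t - h c - (t - c) * dh c| <= e * `|t - c|.
      by near: t.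
    move=> /(_ t01).
    have tc0 : t - c != 0 by rewrite subr_eq0.
    rewrite -ler_pdivrMr ?normr_gt0// -normfV -normrM distrC mulrBl.
    by rewrite [(t - c) * _]mulrC mulfK.
have [c] := MVT ltr01 hder hcont.
rewrite in_itv/= subr0 mulr1 => /dh0 dc /eqP.
by rewrite subr_eq => /eqP ->; rewrite lerDr.
Unshelve. all: by end_near. Qed.

Section Bregman.
Context {R : realType} {n : nat} {N : 'rV[R]_n -> R} {X : set 'rV[R]_n}.
Context {w : 'rV[R]_n -> R} {g : 'rV[R]_n -> 'rV[R]_n}.
Hypotheses (hN : is_norm N) (cX : convex_set X) (kX : compact X).
Hypotheses (hw : C1_on_with_gradient X w g) (hg : strongly_convex_gradient N X g).
Local Notation V := (bregman w g).

(** The derivative of [w] along a segment of [X], in the form required by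
    [ge0_relative_derive_le]. *)
Lemma C1_segment x y (c e : R) : X x -> X y -> 0 <= c <= 1 -> 0 < e ->
  let p (t : R) := x + t *: (y - x) in
  \forall t \near within `[0, 1] (nbhs c),
    `|w (p t) - w (p c) - (t - c) * dotv (g (p c)) (y - x)| <= e * `|t - c|.
Proof.
move=> Xx Xy c01 e0 p.
have Xp (t : R) : 0 <= t <= 1 -> X (p t) by exact: convex_set_segment.
(* The summand [1] covers the degenerate segment [x = y]. *)
have e'0 : 0 < e / (`|y - x| + 1) by rewrite divr_gt0// ltr_wpDl.
have pc : continuous p.
  move=> t; apply: cvgD; first exact: cvg_cst.
  by apply: cvgZr_tmp; exact: cvg_id.
have Hw : \forall z \near p c, X z -> `|w z - w (p c) - dotv (g (p c)) (z - p c)|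
    <= e / (`|y - x| + 1) * `|z - p c| := hw.1 _ (Xp _ c01) _ e'0.
have Hp := pc c _ Hw.
suff : \forall t \near c, `[0, 1]%classic t ->
    `|w (p t) - w (p c) - (t - c) * dotv (g (p c)) (y - x)| <= e * `|t - c| by [].
near=> t; rewrite /= in_itv/= => t01.
have : X (p t) -> `|w (p t) - w (p c) - dotv (g (p c)) (p t - p c)|
    <= e / (`|y - x| + 1) * `|p t - p c| by near: t.
move=> /(_ (Xp _ t01)).
have -> : p t - p c = (t - c) *: (y - x).
  by rewrite /p opprD addrACA subrr add0r -scalerBl.
rewrite dotvZr => /le_trans; apply.
rewrite normrZ mulrCA [leRHS]mulrC ler_wpM2l// -mulrA ger_pMr//.
by rewrite mulrC ler_pdivrMr ?ltr_wpDl// mul1r lerDl.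
Unshelve. all: by end_near. Qed.

Lemma C1_continuous : {within X, continuous w}.
Proof.
apply/subspace_continuousP => x Xx; apply/cvgrPdist_le => e e0.
pose K := n%:R * `|g x| + 1.
have K0 : 0 < K by rewrite ltr_wpDl// mulr_ge0.
have H1 := hw.1 _ Xx _ ltr01.
have near_x : \forall y \near x, `|x - y| <= e / K.
  by apply/nbhs_normP; exists (e / K) => [|y /ltW//] /=; rewrite divr_gt0.
near=> y.
have yx : `|x - y| <= e / K by near: y; exact: cvg_within near_x.
have wy : `|w y - w x - dotv (g x) (y - x)| <= 1 * `|y - x| by near: y.
rewrite ler_pdivlMr// in yx.
rewrite distrC (le_trans _ yx)// [`|x - y|]distrC mulrDr mulr1 [leRHS]addrC.
rewrite -[w y - w x](subrK (dotv (g x) (y - x))).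
rewrite (le_trans (ler_normD _ _))// -[X in _ <= X + _]mul1r lerD//.
by rewrite (le_trans (ler_norm_dotv _ _))// mulrA [leRHS]mulrC.
Unshelve. all: by end_near. Qed.

(** Strong monotonicity of the gradient, integrated along the segment from [x]
    to [y]. *)
Lemma bregman_ge_norm x y : X x -> X y -> N (y - x) ^+ 2 / 2 <= V x y.
Proof.
move=> Xx Xy; have [_ NZ _] := hN.
pose p (t : R) := x + t *: (y - x).
pose a := dotv (g x) (y - x); pose b := N (y - x) ^+ 2.
(* [h 1 - h 0] is [V x y - b / 2], and strong monotonicity between [p t] and
   [x], divided by [t], says that its derivative [dh t] is nonnegative. *)
pose h t := w (p t) - t * a - t ^+ 2 * b / 2.
pose dh t := dotv (g (p t)) (y - x) - a - t * b.
have Xp (t : R) : 0 <= t <= 1 -> X (p t) by exact: convex_set_segment.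
have : h 0 <= h 1.
  apply: (@ge0_relative_derive_le _ _ dh) => [c c01 e e0|c /andP[c0 c1]].
    have e20 : 0 < e / 2 by rewrite divr_gt0.
    have H1 := C1_segment Xx Xy c01 e20.
    have d0 : 0 < e / (b + 1) by rewrite divr_gt0// ltr_wpDl// sqr_ge0.
    have near_c : \forall t \near c, `|c - t| <= e / (b + 1).
      by apply/nbhs_normP; exists (e / (b + 1)) => [//|t /ltW//] /=.
    near=> t.
    have tc : `|c - t| <= e / (b + 1) by near: t; exact: cvg_within near_c.
    have wt : `|w (p t) - w (p c) - (t - c) * dotv (g (p c)) (y - x)|
              <= e / 2 * `|t - c| by near: t.
    have b0 : 0 <= b by exact: sqr_ge0.
    rewrite ler_pdivlMr ?ltr_wpDl// in tc.
    have -> : h t - h c - (t - c) * dh c =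
      (w (p t) - w (p c) - (t - c) * dotv (g (p c)) (y - x))
      - (t - c) ^+ 2 * b / 2 by rewrite /h /dh; field.
    rewrite (le_trans (ler_normB _ _))//.
    have -> : `|(t - c) ^+ 2 * b / 2| = `|t - c| * (`|t - c| * b / 2).
      have half0 : 0 <= 2^-1 :> R by rewrite invr_ge0.
      rewrite normrM normrM normrX (ger0_norm b0) (ger0_norm half0).
      by ring.
    rewrite distrC in tc.
    have tcb : `|t - c| * b / 2 <= e / 2.
      by rewrite ler_wpM2r ?invr_ge0// (le_trans _ tc)// ler_wpM2l// lerDl.
    have := ler_wpM2l (normr_ge0 (t - c)) tcb.
    lra.
  have c01 : 0 <= c <= 1 by rewrite !ltW.
  have := hg (Xp _ c01) Xx.
  have -> : p c - x = c *: (y - x) by rewrite /p addrAC subrr add0r.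
  rewrite NZ dotvZr dotvBl exprMn gtr0_norm// -/a -/b.
  by rewrite expr2 -mulrA ler_pM2l// /dh subr_ge0.
rewrite /h /p !scale0r addr0 scale1r addrCA subrr addr0 /bregman -/a -/b.
lra.
Unshelve. all: by end_near. Qed.

Lemma bregman_ge0 x y : X x -> X y -> 0 <= V x y.
Proof.
move=> Xx Xy; rewrite (le_trans _ (bregman_ge_norm Xx Xy))//.
by rewrite divr_ge0// sqr_ge0.
Qed.

Lemma bregman_three_points z x y :
  V z y = V z x + V x y + dotv (g x - g z) (y - x).
Proof. by rewrite /bregman !dotvBl !dotvBr; ring. Qed.

Lemma compact_bound (U : normedModType R) (f : 'rV[R]_n -> U) :
  {within X, continuous f} -> exists M, forall x, X x -> `|f x| <= M.
Proof.
move=> cf; have [M [_ HM]] := compact_bounded (continuous_compact cf kX).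
exists (M + 1) => x Xx; apply: HM; first by rewrite ltrDl.
by exists x.
Qed.

(** Needed for the supremum defining [prox_diameter] to be an upper bound. *)
Lemma bregman_bounded : exists M, forall x y, X x -> X y -> V x y <= M.
Proof.
have [Mw Hw] := compact_bound C1_continuous.
have [Mg Hg] := compact_bound hw.2.
have [Mx Hx] := @compact_bound _ id (continuous_subspaceT (fun=> cvg_id)).
exists (Mw + Mw + n%:R * (Mg * (Mx + Mx))) => x y Xx Xy.
rewrite /bregman (le_trans (ler_norm _))// (le_trans (ler_normB _ _))// lerD//.
  by rewrite (le_trans (ler_normB _ _))// lerD// Hw.
rewrite (le_trans (ler_norm_dotv _ _))// ler_wpM2l// ler_pM// ?Hg//.
by rewrite (le_trans (ler_normB _ _))// lerD// Hx.
Qed.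

Local Notation Omega := (prox_diameter X w g).

Lemma bregman_le_prox_diameter x y : X x -> X y -> V x y <= Omega ^+ 2 / 2.
Proof.
move=> Xx Xy; have [M HM] := bregman_bounded.
have ub : has_ubound [set V p.1 p.2 | p in X `*` X].
  by exists M => _ [[u v] [/= Xu Xv] <-]; exact: HM.
have le_sup u v : X u -> X v -> V u v <= sup [set V p.1 p.2 | p in X `*` X].
  by move=> Xu Xv; apply: ub_le_sup => //; exists (u, v).
rewrite /prox_diameter sqr_sqrtr; first by rewrite mulrC mulKf ?le_sup.
by rewrite mulr_ge0// (le_trans (bregman_ge0 Xx Xy))// le_sup.
Qed.

Lemma prox_diameter_ge0 : 0 <= Omega.
Proof. exact: sqrtr_ge0. Qed.

Lemma norm_le_prox_diameter x y : X x -> X y -> N (y - x) <= Omega.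
Proof.
move=> Xx Xy; rewrite -ler_sqr ?nnegrE ?prox_diameter_ge0 ?(is_norm_ge0 hN)//.
have := le_trans (bregman_ge_norm Xx Xy) (bregman_le_prox_diameter Xx Xy).
by rewrite ler_pM2r// invr_gt0.
Qed.

(** First-order optimality, from the one-sided derivative of
    [bregman w g z] at [x] in the direction [y - x]. *)
Lemma bregman_argmin_ge0 z x y : X x -> X y ->
  (forall t : R, 0 <= t <= 1 -> V z x <= V z (x + t *: (y - x))) ->
  0 <= dotv (g x - g z) (y - x).
Proof.
move=> Xx Xy xmin.
suff H (e : R) : 0 < e -> - e <= dotv (g x - g z) (y - x).
  rewrite leNgt; apply/negP => lt0.
  have := H (- dotv (g x - g z) (y - x) / 2); lra.
move=> e0.
have c01 : is_true (0 <= (0 : R) <= 1) by rewrite lexx ler01.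
have /nbhs_normP[d /= d0 Hd] : \forall t \near (0 : R), `[0, 1]%classic t ->
   `|w (x + t *: (y - x)) - w (x + 0 *: (y - x))
      - (t - 0) * dotv (g (x + 0 *: (y - x))) (y - x)| <= e * `|t - 0|
  := C1_segment Xx Xy c01 e0.
pose t := Num.min 1 (d / 2).
have t0 : 0 < t by rewrite lt_min ltr01 divr_gt0.
have t1 : t <= 1 by rewrite ge_min lexx.
have t01 : 0 <= t <= 1 by rewrite ltW.
have td : ball_ Num.norm 0 d t.
  rewrite /ball_/= sub0r normrN gtr0_norm// (@le_lt_trans _ _ (d / 2))//.
    by rewrite ge_min lexx orbT.
  by rewrite ltr_pdivrMr// mulr2n mulrDr mulr1 ltrDl.
have := Hd _ td; rewrite /= in_itv/= t01 => /(_ isT).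
rewrite scale0r addr0 !subr0 (gtr0_norm t0) ler_norml => /andP[_ wt].
have := xmin _ t01; rewrite /bregman => le_t.
have eqd : dotv (g z) (x + t *: (y - x) - z) =
    dotv (g z) (x - z) + t * dotv (g z) (y - x).
  by rewrite -dotvZr -dotvDr addrAC.
rewrite eqd in le_t.
by rewrite -(ler_pM2l t0) dotvBl mulrBr; lra.
Qed.

End Bregman.

(** * Bundles *)

Section Bundles.
Context {R : realType} {n : nat}.
Implicit Types (B : seq ('rV[R]_n -> R)) (p : 'rV[R]_n -> R).

Lemma bundle_max_le B y (l : R) :
  (bundle_max B y <= l%:E)%E <-> forall p, p \in B -> p y <= l.
Proof.
rewrite /bundle_max; split=> [Bl p pB|Bl].
  by rewrite -lee_fin (le_trans _ Bl)// (le_bigmax_seq _ _ _ (fun q => (q y)%:E)).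
rewrite big_seq; apply: bigmax_le => [|p pB]; first exact: leNye.
by rewrite lee_fin Bl.
Qed.

Lemma le_bundle_max B p y : p \in B -> ((p y)%:E <= bundle_max B y)%E.
Proof. by move=> pB; exact: (le_bigmax_seq _ _ _ (fun q => (q y)%:E)). Qed.

Lemma bundle_add_mem (D : ctl_data R n) i p B : p \in bundle_add D i p B.
Proof. by rewrite /bundle_add; case: ifP => _; rewrite mem_head. Qed.

Lemma bundle_add_sub (D : ctl_data R n) i p q B :
  q \in bundle_add D i p B -> q = p \/ q \in B.
Proof.
rewrite /bundle_add; case: ifP => _; rewrite inE => /predU1P[->|];
  [by left|by right|by left|].
by rewrite mem_cat => /orP[/mem_take|/mem_drop]; right.
Qed.

End Bundles.

(** * Constants of the complexity bound *)

Section Constants.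
Context {R : realType} (lam thU thL : R).
Hypotheses (hlam : 0 < lam < 1) (hthU : 0 < thU < 1) (hthL : 0 < thL < 1).

(** Factor by which a completed phase shrinks the gap: the first term is the
    case of a large decrease of the upper bound, the second that of a large
    increase of the lower bound. *)
Definition contraction : R :=
  Num.max (1 - lam * (1 - thU)) (1 - (1 - lam) * (1 - thL)).

(** In a phase started at gap [d], [steps_const * Lphi^2 * Omega^2 / d^2] bounds
    the number of iterations that do not end the phase. *)
Definition steps_const : R := ((thU * lam) ^+ 2)^-1.

(** A phase started at gap [d] costs at most
    [(1 + steps_const) * Lphi^2 * Omega^2 / d^2] iterations; dividing by
    [1 - contraction ^+ 2] sums the geometric series over the phases. *)
Definition phases_const : R := (1 + steps_const) / (1 - contraction ^+ 2).

Lemma contraction_itv : 0 <= contraction < 1.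
Proof.
have [/andP[l0 l1] /andP[U0 U1] /andP[L0 L1]] := And3 hlam hthU hthL.
rewrite /contraction le_max gt_max; apply/andP; split.
  by apply/orP; left; nra.
by apply/andP; split; nra.
Qed.

Lemma steps_const_ge0 : 0 <= steps_const.
Proof. by rewrite invr_ge0 sqr_ge0. Qed.

Lemma phases_constP :
  contraction ^+ 2 * (phases_const + steps_const + 1) <= phases_const.
Proof.
have /andP[c0 c1] := contraction_itv; have s0 := steps_const_ge0.
have sq1 : contraction ^+ 2 < 1 by nra.
have sq0 : 0 <= contraction ^+ 2 by rewrite sqr_ge0.
have : phases_const * (1 - contraction ^+ 2) = 1 + steps_const.
  by rewrite divfK// subr_eq0 gt_eqF.
nra.
Qed.

Lemma phases_const_ge0 : 0 <= phases_const.
Proof.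
have /andP[c0 c1] := contraction_itv; have s0 := steps_const_ge0.
by apply: divr_ge0; [exact: addr_ge0|rewrite subr_ge0; nra].
Qed.

End Constants.

(** * Oracle pieces and the auxiliary problem *)

Lemma closed_sublevel (T : topologicalType) (R : realType) (X : set T)
    (h : T -> R) (l : R) :
  closed X -> {within X, continuous h} -> closed (X `&` [set y | h y <= l]).
Proof.
move=> Xc hc; have /continuous_closedP/(_ _ (@closed_le R l)) := hc.
move=> /closed_subspaceP[U Uc UX].
have -> : X `&` [set y | h y <= l] = U `&` X by rewrite UX setIC.
exact: closedI.
Qed.

Section Oracle.
Context {R : realType} {n : nat} {N : 'rV[R]_n -> R} {X : set 'rV[R]_n}.
Context {psi f : 'rV[R]_n -> R} {fpiece : 'rV[R]_n -> 'rV[R]_n -> R}.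
Context {w : 'rV[R]_n -> R} {g : 'rV[R]_n -> 'rV[R]_n}.
Context {lam thU thL L : R} {tau : nat}.
Let D := CtlData X psi f fpiece w g lam thU thL tau.
Hypotheses (hN : is_norm N) (cX : convex_set X) (clX : closed X) (kX : compact X).
Hypotheses (hw : C1_on_with_gradient X w g) (hg : strongly_convex_gradient N X g).
Hypothesis psi_convex : convex_function X psi.
Hypothesis piece_spec : forall x, X x ->
  [/\ lipschitz_wrt N X (fpiece x), convex_function X (fpiece x),
      forall y, X y -> fpiece x y <= f y & fpiece x x = f x].
Hypothesis piece_lip : forall x, X x -> lipschitz_wrt_with N X L (ctl_piece D x).
Hypothesis L_ge0 : 0 <= L.
Local Notation V := (bregman w g).
Local Notation phi := (ctl_phi D).
Local Notation Omega := (prox_diameter X w g).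
Implicit Types (B : seq ('rV[R]_n -> R)) (l : R) (x y z xbar : 'rV[R]_n).

Lemma piece_le x y : X x -> X y -> ctl_piece D x y <= phi y.
Proof. by move=> /piece_spec[_ _ H _] Xy; rewrite lerD2l; exact: H. Qed.

Lemma piece_diag x : X x -> ctl_piece D x x = phi x.
Proof. by move=> /piece_spec[_ _ _ H]; congr (_ + _). Qed.

Lemma piece_segment x y z (t : R) : X x -> X y -> X z -> 0 <= t <= 1 ->
  ctl_piece D x (y + t *: (z - y)) <=
  ctl_piece D x y + t * (ctl_piece D x z - ctl_piece D x y).
Proof.
move=> /piece_spec[_ cf _ _] Xy Xz t01.
have := convex_function_segment psi_convex Xy Xz t01.
have := convex_function_segment cf Xy Xz t01.
rewrite /ctl_piece/=; lra.
Qed.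

Lemma piece_lower_bound x y : X x -> X y ->
  ctl_piece D x x - L * Omega <= ctl_piece D x y.
Proof.
move=> Xx Xy; have := piece_lip Xx Xx Xy.
have := norm_le_prox_diameter hN cX kX hw hg Xy Xx.
move=> /(ler_wpM2l L_ge0) H1; rewrite ler_norml => /andP[_]; lra.
Qed.

Definition oracle_bundle B :=
  forall p, p \in B -> exists2 x, X x & p = ctl_piece D x.

Lemma bundle_max_le_phi B y : oracle_bundle B -> X y ->
  (bundle_max B y <= (phi y)%:E)%E.
Proof.
by move=> oB Xy; apply/bundle_max_le => p /oB[x Xx ->]; exact: piece_le.
Qed.

(** The set is written as a sublevel set of an affine function restricted to
    [X], to which [closed_sublevel] applies. *)
Lemma closed_cut xbar x : closed (Defs.cut D xbar x).
Proof.
pose c := g x - g xbar.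
have hc : {within X, continuous (fun y => - dotv c (y - x))}.
  apply: (lipschitz_wrt_continuous is_norm_sup); exists (n%:R * `|c|) => u v _ _.
  rewrite opprK addrC -dotvBr opprB addrA subrK -mulrA.
  by rewrite [`|u - v|]distrC; exact: ler_norm_dotv.
have := closed_sublevel (l := 0) clX hc; congr closed.
by apply/seteqP; split => y [/= Xy]; rewrite oppr_le0.
Qed.

Lemma compact_query_feasible B l xbar x : oracle_bundle B ->
  compact (query_feasible D B l xbar x).
Proof.
move=> oB; apply: (subclosed_compact _ kX); last by move=> y [[]].
have -> : query_feasible D B l xbar x = Defs.cut D xbar x `&`
    \bigcap_(p in [set p | p \in B]) (X `&` [set y | p y <= l]).
  apply/seteqP; split=> y [cy /=].
    move=> /bundle_max_le By; split=> // p pB.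
    by split; [case: cy|exact: By].
  by move=> By; split=> //=; apply/bundle_max_le => p /By[].
apply: closedI; first exact: closed_cut.
apply: closed_bigI => p /oB[z Xz ->]; apply: closed_sublevel => //.
by apply: (lipschitz_wrt_continuous hN); exists L; exact: piece_lip.
Qed.

Lemma query_feasible_segment B l xbar x y z (t : R) : oracle_bundle B ->
  query_feasible D B l xbar x y -> query_feasible D B l xbar x z ->
  0 <= t <= 1 -> query_feasible D B l xbar x (y + t *: (z - y)).
Proof.
move=> oB [[Xy cy] /= /bundle_max_le By] [[Xz cz] /= /bundle_max_le Bz] t01.
have /andP[t0 t1] := t01.
split; first split.
- exact: convex_set_segment.
- have -> : y + t *: (z - y) - x = (1 - t) *: (y - x) + t *: (z - x).
    rewrite !scalerBr !scalerBl !scale1r.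
    by rewrite !opprB; apply/rowP => i; rewrite !mxE; ring.
  by rewrite dotvDr !dotvZr addr_ge0// mulr_ge0// subr_ge0.
- apply/bundle_max_le => p pB; have [u Xu pE] := oB _ pB.
  have Hy := By _ pB; have Hz := Bz _ pB; rewrite {}pE in Hy Hz *.
  rewrite (le_trans (piece_segment Xu Xy Xz t01))//.
  have := ler_wpM2l t0 Hz; have t1' : 0 <= 1 - t by rewrite subr_ge0.
  have := ler_wpM2l t1' Hy; lra.
Qed.

Lemma bregman_continuous xbar : {within X, continuous (V xbar)}.
Proof.
rewrite /bregman; apply: within_continuousB; first apply: within_continuousB.
- exact: C1_continuous hw.
- by apply: continuous_subspaceT; exact: cst_continuous.
- apply: (lipschitz_wrt_continuous is_norm_sup).
  exists (n%:R * `|g xbar|) => u v _ _.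
  by rewrite -dotvBr opprB addrA subrK -mulrA; exact: ler_norm_dotv.
Qed.

(** The auxiliary problem is solvable by compactness; by first-order optimality
    its solution cuts off no feasible point. *)
Lemma next_queryP B l xbar x (x' := next_query D B l xbar x) :
  oracle_bundle B -> X xbar -> query_feasible D B l xbar x !=set0 ->
  query_feasible D B l xbar x x' /\
  forall y, query_feasible D B l xbar x y -> 0 <= dotv (g x' - g xbar) (y - x').
Proof.
move=> oB Xb F0; set F := query_feasible D B l xbar x in F0 *.
have FX y : F y -> X y by move=> [[]].
have Fc : {within F, continuous (V xbar)}.
  exact: continuous_subspaceW FX (bregman_continuous (xbar := xbar)).
have [c /set_mem Fm cmin] := EVT_min_rV F0 (compact_query_feasible oB) Fc.
have [] : F x' /\ forall z, F z -> V xbar x' <= V xbar z.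
  rewrite /x' /next_query/=; case: xgetP => [y _ //|/(_ c)[]].
  by split=> // z /mem_set/cmin.
move=> Fx' x'min; split=> // y Fy.
apply: (bregman_argmin_ge0 cX hw); [exact: FX|exact: FX|] => t t01.
by apply: x'min; exact: query_feasible_segment.
Qed.

(** The candidate lower bound computed in an iteration. *)
Definition level_bound B l xbar x : R :=
  fine (Order.min (cut_min D B xbar x) l%:E).

(** [fine] would send [-oo] to [0]; any single piece in the bundle bounds the
    model from below on [X] and excludes this. *)
Lemma level_boundE B l xbar x z : oracle_bundle B -> X z -> ctl_piece D z \in B ->
  (level_bound B l xbar x)%:E = Order.min (cut_min D B xbar x) l%:E.
Proof.
move=> oB Xz zB; rewrite fineK// fin_real//; apply/andP; split; last first.
  by rewrite gt_min ltry orbT.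
rewrite lt_min ltNyr andbT.
apply: (@lt_le_trans _ _ (ctl_piece D z z - L * Omega)%:E); first exact: ltNyr.
apply/ereal_infP => _ [y [Xy _] <-].
by rewrite (le_trans _ (le_bundle_max _ zB))// lee_fin piece_lower_bound.
Qed.

(** A level bound below the level is witnessed by a point of the cut where the
    model is below the level: a phase that continues has a next query point. *)
Lemma level_bound_lt B l xbar x z : oracle_bundle B -> X z ->
  ctl_piece D z \in B -> level_bound B l xbar x < l ->
  query_feasible D B l xbar x !=set0.
Proof.
move=> oB Xz zB; rewrite -lte_fin (level_boundE _ _ _ oB Xz zB).
rewrite gt_min ltxx orbF => /ereal_inf_lt[_ [y cy <-] yl].
by exists y; split=> //=; exact: ltW.
Qed.

(** Points above the level are bounded by the truncation, points below it belong
    to the cut, where the model minorizes the objective. *)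
Lemma level_bound_le_phi B l xbar x z y : oracle_bundle B -> X z ->
  ctl_piece D z \in B -> X y ->
  (phi y <= l -> 0 <= dotv (g x - g xbar) (y - x)) ->
  level_bound B l xbar x <= phi y.
Proof.
move=> oB Xz zB Xy ycut; rewrite -lee_fin (level_boundE _ _ _ oB Xz zB).
have [yl|/ltW ly] := leP (phi y) l; last by rewrite ge_min lee_fin ly orbT.
rewrite ge_min; apply/orP; left; apply: ge_ereal_inf.
exists (bundle_max B y); last exact: bundle_max_le_phi.
by exists y => //; split=> //; exact: ycut.
Qed.

(** * The potential along a run *)

Hypotheses (hlam : 0 < lam < 1) (hthU : 0 < thU < 1) (hthL : 0 < thL < 1).

Local Notation M := ((L * Omega) ^+ 2).
Local Notation theta := (contraction lam thU thL).
Local Notation Csteps := (steps_const lam thU).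
Local Notation Cphases := (phases_const lam thU thL).

Definition state_inv (s : ctl_state R n) : Prop :=
  [/\ X (st_xhat s), phi (st_xhat s) = st_ub s,
      forall y, X y -> st_lb s <= phi y, oracle_bundle (st_bundle s)
    & st_ub s - st_lb s <= L * Omega].

(** During a phase, [k * d^2] is kept below this quantity; the first term is
    what has been spent before the phase. *)
Definition potential (P : ctl_phase R n) : R :=
  Cphases * M + Csteps * (2 * L ^+ 2 * V (ph_center P) (ph_query P)).

(** The third condition says that the cut at the query point keeps the whole
    level set of [phi]; [d] is the gap at the start of the phase, from which the
    two bounds can only have moved towards each other. *)
Definition phase_inv (k : nat) (s : ctl_state R n) (P : ctl_phase R n) : Prop :=
  [/\ X (ph_center P), X (ph_query P),
      forall y, X y -> phi y <= ph_level P ->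
        0 <= dotv (g (ph_query P) - g (ph_center P)) (y - ph_query P)
    & exists d, [/\ 0 <= d <= L * Omega,
        ph_gapU P = lam * d, ph_gapL P = (1 - lam) * d,
        ph_level P - ph_gapL P <= st_lb s <= st_ub s
          /\ st_ub s <= ph_level P + ph_gapU P
      & k%:R * d ^+ 2 <= potential P]].

Definition ctl_inv (k : nat) (s : ctl_state R n) : Prop :=
  state_inv s /\ match st_phase s with
  | Some P => phase_inv k s P
  | None => k%:R * (st_ub s - st_lb s) ^+ 2 <= Cphases * M
  end.

Lemma state_inv_gap_ge0 s : state_inv s -> st_lb s <= st_ub s.
Proof. by move=> [Xh <- lb _ _]; exact: lb. Qed.

Lemma open_phase_inv k s xbar : state_inv s -> X xbar ->
  k%:R * (st_ub s - st_lb s) ^+ 2 <= Cphases * M ->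
  phase_inv k s (open_phase D xbar s).
Proof.
move=> sI Xb kM; have lu := state_inv_gap_ge0 sI; have [_ _ _ _ gapM] := sI.
split=> //=; first by move=> y _ _; rewrite subrr dotv0l.
exists (st_ub s - st_lb s); split; rewrite ?subr_ge0 ?lu//=.
- by ring.
- by ring.
- by rewrite andbT; split; lra.
- rewrite /potential/=.
  have -> : V xbar xbar = 0.
    by rewrite /bregman !subrr /dotv big1 ?subrr// => i _; rewrite mxE mulr0.
  by rewrite !mulr0 addr0.
Qed.

Lemma potential_le P : X (ph_center P) -> X (ph_query P) ->
  potential P <= (Cphases + Csteps) * M.
Proof.
move=> Xc Xq; rewrite mulrDl lerD2l ler_wpM2l ?steps_const_ge0//.
have := bregman_le_prox_diameter hN cX kX hw hg Xc Xq.
have L2 : 0 <= 2 * L ^+ 2 by rewrite mulr_ge0// sqr_ge0.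
move=> /(ler_wpM2l L2); rewrite exprMn; lra.
Qed.

(** The constant [Cphases] is chosen so that the potential accumulated
    during a phase is absorbed by the decrease of the gap at its end. *)
Lemma end_phase_inv k P (d gap : R) : X (ph_center P) -> X (ph_query P) ->
  0 <= d <= L * Omega -> k%:R * d ^+ 2 <= potential P ->
  0 <= gap <= theta * d ->
  k.+1%:R * gap ^+ 2 <= Cphases * M.
Proof.
move=> Xc Xq /andP[d0 dM] kP /andP[g0 gd].
have /andP[c0 c1] := contraction_itv hlam hthU hthL.
have gd2 : gap ^+ 2 <= theta ^+ 2 * d ^+ 2.
  by rewrite -exprMn ler_sqr ?nnegrE ?mulr_ge0.
have dM2 : d ^+ 2 <= M by rewrite ler_sqr ?nnegrE// (le_trans d0).
rewrite (le_trans (ler_wpM2l _ gd2))// mulrCA -natr1 mulrDl mul1r.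
have H : k%:R * d ^+ 2 + d ^+ 2 <= (Cphases + Csteps + 1) * M.
  rewrite [leRHS]mulrDl mul1r lerD// (le_trans kP)//; exact: potential_le.
rewrite (le_trans (ler_wpM2l (sqr_ge0 theta) H))// mulrA.
by rewrite ler_wpM2r ?sqr_ge0// (phases_constP hlam hthU hthL).
Qed.

(** The Lipschitz bound turns a drop of the piece at [x] into a distance from
    [x] to [x'], and the cut turns this distance into an increase of [V c]. *)
Lemma potential_step (d : R) c x x' : 0 <= d -> X c -> X x -> X x' ->
  0 <= dotv (g x - g c) (x' - x) ->
  thU * (lam * d) <= ctl_piece D x x - ctl_piece D x x' ->
  d ^+ 2 <= Csteps * (2 * L ^+ 2 * (V c x' - V c x)).
Proof.
move=> d0 Xc Xx Xx' cut_x' drop.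
have [/andP[l0 _] /andP[U0 _]] := conj hlam hthU.
have V2 : N (x' - x) ^+ 2 <= 2 * (V c x' - V c x).
  have := bregman_ge_norm hN cX hw hg Xx Xx'.
  by rewrite (bregman_three_points c x x'); lra.
have LN : thU * lam * d <= L * N (x' - x).
  rewrite -mulrA (le_trans drop)// -(is_normN hN) opprB (le_trans (ler_norm _))//.
  exact: piece_lip.
have p0 : 0 <= thU * lam * d by rewrite !mulr_ge0// ltW.
have LN2 : (thU * lam) ^+ 2 * d ^+ 2 <= L ^+ 2 * N (x' - x) ^+ 2.
  by rewrite -!exprMn ler_sqr ?nnegrE// (le_trans p0).
rewrite /steps_const ler_pdivlMl ?exprn_gt0 ?mulr_gt0//.
by rewrite (le_trans LN2)// [leRHS]mulrAC [leRHS]mulrC ler_wpM2l ?sqr_ge0.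
Qed.

(** The three branches of an iteration: a large decrease of the upper bound or
    a large increase of the lower bound contracts the gap and ends the phase;
    otherwise the next query point has a larger Bregman distance from the
    prox-center. *)
Lemma ctl_iter_inv k s xbar i : ctl_inv k s -> X xbar ->
  ctl_inv k.+1 (ctl_iter D xbar i s).
Proof.
move=> [sI pI] Xb; rewrite /ctl_iter.
set P := (if st_phase s is Some P then P else open_phase D xbar s).
have {pI} : phase_inv k s P.
  by rewrite /P; case: (st_phase s) pI => [//|]; exact: open_phase_inv.
move: P => P [Xc Xx below [d [/andP[d0 dM] gU gL [/andP[lb_ge lu] ub_le] kd]]].
rewrite -[ctl_thU D]/thU -[ctl_thL D]/thL.
have [Xh phih lb_phi oB gapM] := sI.
set x := ph_query P in Xx below *; set c := ph_center P in Xc below *.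
set l := ph_level P in below lb_ge ub_le *.
set ub := (if _ then phi x else st_ub s).
set xhat := (if _ then x else st_xhat s).
set B := bundle_add _ _ _ _.
have [Xh' phih'] : X xhat /\ phi xhat = ub.
  by rewrite /xhat /ub; case: ifP.
have ub_x : ub <= phi x by rewrite /ub; case: ltP.
have ub_s : ub <= st_ub s by rewrite /ub; case: ltP => // /ltW.
have oB' : oracle_bundle B.
  by move=> p /bundle_add_sub[->|/oB//]; exists x.
have xB : ctl_piece D x \in B by exact: bundle_add_mem.
have end_inv (lb : R) : st_lb s <= lb -> (forall y, X y -> lb <= phi y) ->
    ub - lb <= theta * d -> ctl_inv k.+1 (CtlState ub lb xhat B None).
  move=> lb_s lbphi gd; split.
    by split=> //=; rewrite (le_trans _ gapM)// lerB.
  apply: (@end_phase_inv k P d) => //=; first by rewrite d0.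
  by rewrite gd andbT subr_ge0 -phih' lbphi.
have [/andP[l0 l1] /andP[U0 U1] /andP[L0 L1]] := And3 hlam hthU hthL.
case: ifPn => [stopU|]; last rewrite -ltNge => stopU.
  apply: end_inv => //.
  apply: (@le_trans _ _ ((1 - lam * (1 - thU)) * d)).
    move: stopU lb_ge ub_x; rewrite gU gL; lra.
  by rewrite ler_wpM2r// le_max lexx.
rewrite -[fine _]/(level_bound B l c x).
set lb := Num.max _ _.
have lb_s : st_lb s <= lb by rewrite le_max lexx.
have lbphi y : X y -> lb <= phi y.
  move=> Xy; rewrite ge_max lb_phi//=.
  by apply: (level_bound_le_phi oB' Xx xB Xy) => yl; exact: below.
case: ifPn => [stopL|]; last rewrite -ltNge => stopL.
  apply: end_inv => //.
  apply: (@le_trans _ _ ((1 - (1 - lam) * (1 - thL)) * d)).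
    move: stopL ub_le ub_s; rewrite gU gL; lra.
  by rewrite ler_wpM2r// le_max lexx orbT.
(* Both tests failed, so the phase goes on. *)
have feas : query_feasible D B l c x !=set0.
  apply: (level_bound_lt oB' Xx xB).
  have : lb < l.
    rewrite -subr_gt0 (le_lt_trans _ stopL)// gL !mulr_ge0// ?subr_ge0 ltW//.
  by rewrite gt_max => /andP[].
have [[[Xx' cut_x'] /= /bundle_max_le x'_lev] x'_opt] := next_queryP oB' Xc feas.
set x' := next_query _ _ _ _ _ in Xx' cut_x' x'_lev x'_opt *.
split; first by split=> //=; rewrite (le_trans _ gapM)// lerB.
split=> //=.
  move=> y Xy yl; apply: x'_opt; split; first by split=> //; exact: below.
  by rewrite /= (le_trans (bundle_max_le_phi oB' Xy))// lee_fin.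
exists d; split=> //; first by rewrite d0.
  split; last by rewrite (le_trans ub_s).
  by rewrite (le_trans lb_ge)//= -phih' lbphi.
rewrite -natr1 mulrDl mul1r.
have := potential_step d0 Xc Xx Xx' cut_x'.
rewrite (piece_diag Xx) => step.
have := x'_lev _ xB => /= px'.
have {}step : d ^+ 2 <= Csteps * (2 * L ^+ 2 * (V c x' - V c x)).
  by apply: step; move: stopU; rewrite gU; lra.
move: kd; rewrite /potential/= -/x -/c; lra.
Qed.

Lemma ctl_init_inv x : X x -> ctl_inv 0 (ctl_init D x).
Proof.
move=> Xx; split; last by rewrite mul0r mulr_ge0 ?sqr_ge0// phases_const_ge0.
have lbd y : X y -> ctl_piece D x x - L * Omega <= ctl_piece D x y.
  exact: piece_lower_bound.
split=> //=.
- move=> y Xy; rewrite (le_trans _ (piece_le Xx Xy))//.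
  apply: ge_inf; last by exists y.
  by exists (ctl_piece D x x - L * Omega) => _ [z Xz <-]; exact: lbd.
- by move=> p; rewrite inE => /eqP ->; exists x.
- rewrite -(piece_diag Xx) lerBlDr addrC -lerBlDr.
  apply: lb_le_inf => [|_ [y Xy <-]]; last exact: lbd.
  by exists (ctl_piece D x x), x.
Qed.

Lemma ctl_run_inv xini center rm k : X xini -> (forall j, X (center j)) ->
  ctl_inv k (ctl_run D xini center rm k).
Proof.
move=> Xini Xc; elim: k => [|k IHk] /=; first exact: ctl_init_inv.
exact: ctl_iter_inv.
Qed.

(** Within a phase, the current gap is at most the initial one. *)
Lemma ctl_inv_gap k s : ctl_inv k s ->
  k%:R * (st_ub s - st_lb s) ^+ 2 <= (Cphases + Csteps) * M.
Proof.
move=> [sI]; case: (st_phase s) => [P|kM]; last first.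
  by rewrite (le_trans kM)// ler_wpM2r ?sqr_ge0// lerDl steps_const_ge0.
move=> [Xc Xq _ [d [/andP[d0 _] gU gL [/andP[lb_ge lu] ub_le] kd]]].
rewrite (le_trans _ (potential_le Xc Xq))// (le_trans _ kd)//.
rewrite ler_wpM2l// ler_sqr ?nnegrE ?subr_ge0//.
by move: lb_ge ub_le; rewrite gU gL; lra.
Qed.

End Oracle.

Theorem propositionA1 (R : realType) (lam thU thL : R)
  (hlam : 0 < lam < 1) (hthU : 0 < thU < 1) (hthL : 0 < thL < 1) :
  exists C : R,
  forall (n : nat) (N : 'rV[R]_n -> R) (X : set 'rV[R]_n)
    (psi f : 'rV[R]_n -> R) (fpiece : 'rV[R]_n -> 'rV[R]_n -> R)
    (w : 'rV[R]_n -> R) (g : 'rV[R]_n -> 'rV[R]_n) (Lphi : R) (tau : nat)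
    (xini : 'rV[R]_n) (center : nat -> 'rV[R]_n) (rm : nat -> nat),
  let D := CtlData X psi f fpiece w g lam thU thL tau in
  let Omega := prox_diameter X w g in
  let Opt := minval X (ctl_phi D) in
  let run := ctl_run D xini center rm in
  X !=set0 -> convex_set X -> closed X -> bounded_set X ->
  lipschitz_wrt N X psi -> convex_function X psi ->
  lipschitz_wrt N X f -> convex_function X f ->
  is_norm N ->
  C1_on_with_gradient X w g -> strongly_convex_gradient N X g ->
  (forall x, X x ->
     [/\ lipschitz_wrt N X (fpiece x), convex_function X (fpiece x),
         forall y, X y -> fpiece x y <= f y & fpiece x x = f x]) ->
  (forall x, X x -> lipschitz_wrt_with N X Lphi (ctl_piece D x)) ->
  (1 <= tau)%N -> X xini -> (forall k, X (center k)) ->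
  (forall k, (rm k < tau)%N) ->
  forall eps : R, 0 < eps < Lphi * Omega ->
  exists k : nat,
    [/\ k%:R <= C * (Lphi * Omega / eps) ^+ 2,
        st_ub (run k) - st_lb (run k) <= eps,
        X (st_xhat (run k))
      & ctl_phi D (st_xhat (run k)) - Opt <= eps].
Proof.
pose C := phases_const lam thU thL + steps_const lam thU.
(* The summand [1] pays for rounding the iteration number up, since
   [eps < Lphi * Omega]. *)
exists (C + 1) => n N X psi f fpiece w g L tau xini center rm D Omega Opt run.
move=> X0 cX clX bX _ psi_convex _ _ hN hw hg piece_spec piece_lip _ Xini Xc _.
move=> eps /andP[eps0 epsM].
have kX : compact X by exact: bounded_closed_compact.
have L_ge0 : 0 <= L.
  rewrite leNgt; apply/negP => L0; move: (lt_trans eps0 epsM).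
  by rewrite ltNge mulr_le0_ge0 ?(ltW L0)// sqrtr_ge0.
have inv k := ctl_run_inv hN cX clX kX hw hg psi_convex piece_spec piece_lip
  L_ge0 hlam hthU hthL rm k Xini Xc.
pose r := (L * Omega / eps) ^+ 2.
have C0 : 0 <= C by rewrite addr_ge0 ?phases_const_ge0 ?steps_const_ge0.
have r1 : 1 <= r by rewrite exprn_ege1// ler_pdivlMr// mul1r ltW.
have Cr0 : 0 <= C * r by rewrite mulr_ge0// (le_trans ler01).
pose k := (Num.truncn (C * r)).+1.
have /andP[k_le k_gt] := truncn_itv Cr0.
have gap_eps : st_ub (run k) - st_lb (run k) <= eps.
  rewrite leNgt; apply/negP => gap_gt.
  have gap2 : eps ^+ 2 < (st_ub (run k) - st_lb (run k)) ^+ 2.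
    by rewrite ltr_sqr ?nnegrE ?ltW// (lt_trans eps0).
  have := ctl_inv_gap hN cX kX hw hg (inv k).
  rewrite leNgt => /negP; apply.
  apply: (@lt_trans _ _ (k%:R * eps ^+ 2)); last by rewrite ltr_pM2l// ltr0n.
  have -> : (L * prox_diameter X w g) ^+ 2 = r * eps ^+ 2.
    by rewrite /r expr_div_n divfK// expf_neq0// gt_eqF.
  by rewrite mulrA ltr_pM2r// exprn_gt0.
have [[Xh phih lbphi _ _] _] := inv k.
exists k; split=> //.
- by rewrite /k -[leLHS]natr1 [leRHS]mulrDl mul1r lerD.
- rewrite (le_trans _ gap_eps)// phih lerB//.
  apply: lb_le_inf => [|_ [y Xy <-]]; last exact: lbphi.
  by case: X0 => y Xy; exists (ctl_phi D y), y.
Qed.
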